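(* Let $d\ge1$ and let $g$ be a rigid Carmichael polynomial of order $d$ in $\mathbb{F}_q[t]$. Then $g$ is Carmichael in every finite separable extension $K$ of $\mathbb{F}_q(t)$ of degree $d$ whose discriminant is relatively prime to $g$.
   Context: $\mathbb{F}_q$ is the finite field with $q$ elements. A rigid Carmichael polynomial of order $d$ in $\mathbb{F}_q[t]$ is a reducible square-free polynomial $g$ such that $i\cdot\deg P$ divides $d\cdot\deg g$ for every irreducible polynomial $P$ dividing $g$ and every $i=1,\dots,d$. A finite ring $S$ is a Carmichael ring if $S$ is not a field and $a^{|S|}=a$ for every $a\in S$; an ideal $I$ of a ring $R$ is a Carmichael ideal if $R/I$ is a Carmichael ring. For a finite extension $K$ of $\mathbb{F}_q(t)$, $\mathcal{O}_K$ denotes the integral closure of $\mathbb{F}_q[t]$ in $K$, and an element $\alpha\in\mathcal{O}_K$ is Carmichael in $K$ if $\alpha\mathcal{O}_K$ is a Carmichael ideal of $\mathcal{O}_K$. The discriminant of $K$ is the discriminant ideal of $\mathcal{O}_K$ over $\mathbb{F}_q[t]$; ''relatively prime to $g$'' means no irreducible factor of $g$ divides it. *)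

(* Defs.v *)
From HB Require Import structures.
From mathcomp Require Import all_boot all_order all_algebra all_field.
From mathcomp Require Import fraction.
Set Implicit Arguments. Unset Strict Implicit. Unset Printing Implicit Defensive.
Import GRing.Theory.
Local Open Scope ring_scope.
Local Notation "x %:F" := (@FracField.tofrac _ x).

Definition pdeg (F : fieldType) (p : {poly F}) : nat := (size p).-1.

Definition reducible_poly (F : fieldType) (g : {poly F}) : Prop :=
  (1 < size g)%N /\ ~ irreducible_poly g.

Definition squarefree_poly (F : fieldType) (g : {poly F}) : Prop :=
  g != 0 /\ forall p : {poly F}, (1 < size p)%N -> ~ (p * p %| g).

Definition rigid_carmichael (F : fieldType) (d : nat) (g : {poly F}) : Prop :=
  reducible_poly g /\ squarefree_poly g /\
  forall P : {poly F}, irreducible_poly P -> P %| g ->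
    forall i : nat, (1 <= i <= d)%N -> (i * pdeg P %| d * pdeg g)%N.

Section ExtDefs.
Variable F : fieldType.
Local Notation Fpt := {poly F}.
Local Notation Kt := {fraction {poly F}}.
Variable K : fieldExtType Kt.

Definition embK (p : Fpt) : K := (p%:F)%:A.

Definition integralK (x : K) : Prop :=
  exists p : {poly Fpt}, p \is monic /\ root (map_poly embK p) x.

Definition congrK (alpha x y : K) : Prop :=
  exists z : K, integralK z /\ x - y = alpha * z.

Definition quot_card (alpha : K) (N : nat) : Prop :=
  exists s : seq K, size s = N /\
    (forall i, (i < N)%N -> integralK (nth 0 s i)) /\
    (forall i j, (i < N)%N -> (j < N)%N -> congrK alpha (nth 0 s i) (nth 0 s j) -> i = j) /\
    (forall x : K, integralK x -> exists2 i, (i < N)%N & congrK alpha x (nth 0 s i)).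

Definition quot_is_field (alpha : K) : Prop :=
  ~ congrK alpha 1 0 /\
  forall a : K, integralK a -> ~ congrK alpha a 0 ->
    exists2 b : K, integralK b & congrK alpha (a * b) 1.

Definition carmichael_in (alpha : K) : Prop :=
  integralK alpha /\
  exists N : nat, quot_card alpha N /\ ~ quot_is_field alpha /\
    forall a : K, integralK a -> congrK alpha (a ^+ N) a.

Definition traceK (x : K) : Kt :=
  \tr (passmx.mxof (vbasis {:K}) (vbasis {:K}) (amulr x)).

Definition discK (d : nat) (x : 'I_d -> K) : Kt :=
  \det (\matrix_(i < d, j < d) traceK (x i * x j)).

(* the discriminant ideal of O_K over F_q[t] (generated by the discriminants
   of d-tuples of elements of O_K, d = [K : F_q(t)]) is contained in P F_q[t] *)
Definition P_divides_disc (P : Fpt) : Prop :=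
  forall x : 'I_(\dim {:K}) -> K, (forall i, integralK (x i)) ->
    exists h : Fpt, discK x = (P * h)%:F.

Definition disc_coprime (g : Fpt) : Prop :=
  forall P : Fpt, irreducible_poly P -> P %| g -> ~ P_divides_disc P.
End ExtDefs.

(* Main.v *)
Require Import Defs.
From HB Require Import structures.
From mathcomp Require Import all_boot all_order all_algebra all_field.
From mathcomp Require Import fraction.
From Stdlib Require Import Classical_Prop.
Import GRing.Theory.
Local Open Scope ring_scope.

(** Write A = F[t], O for its integral closure in K, and Tr for the trace. In
characteristic p one has Tr(x^p) = Tr(x)^p, so for x in O all powers Tr(x)^(p^e)
lie in D^-1 A for a fixed D, which forces Tr(x) to be in A. Since the discriminant
is prime to g, the Chinese remainder theorem gives d elements of O whose
discriminant is prime to g; by Cramer's rule they form a basis of O/gO over A/g,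
so |O/gO| = N with N = q^(d deg g). The same trace form shows that O/PO is reduced
for every irreducible P dividing g. Finally, if a is in O and Q = |A/P|, the
elements 1, a, ..., a^d are linearly dependent over A/P, so the Moore determinant
det(a^(j Q^i)) vanishes mod P. It is a Vandermonde determinant, a product of
Q^i-th powers of elements a^(Q^f) - a with 1 <= f <= d, all of which divide a^N - a
by rigidity. Hence a^N - a is nilpotent mod P, and so zero mod P, for every P. *)

Set Implicit Arguments.
Unset Strict Implicit.
Unset Printing Implicit Defensive.

Local Notation "x %:F" := (@FracField.tofrac _ x).

(** * The Frobenius map and traces of matrices in characteristic [p] *)

Lemma coef_pFrobenius (R : comNzRingType) (p : nat) (f : {poly R}) (k : nat) :
  p \in [pchar R] -> (f ^+ p)`_(k * p) = f`_k ^+ p.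
Proof.
move=> pcharRp; have pr_p := pcharf_prime pcharRp.
have pcharPp : p \in [pchar {poly R}] by rewrite pchar_poly.
(* The Frobenius map of [{poly R}] is additive, so the monomials of [f] are raised to the [p]-th
   power one by one. *)
rewrite -[f in LHS]coefK poly_def -(pFrobenius_autE pcharPp) rmorph_sum /= coef_sum.
under eq_bigr => i _.
  rewrite pFrobenius_autE exprZn -exprM coefZ coefXn eqn_pmul2r ?prime_gt0 //.
  over.
case: (ltnP k (size f)) => [ltk|lek].
  rewrite (bigD1 (Ordinal ltk)) //= eqxx mulr1 big1 ?addr0 // => i ne_ik.
  by rewrite eq_sym (negPf (ne_ik : i != k :> nat)) mulr0.
rewrite big1 => [|i _]; last by rewrite gtn_eqF ?mulr0 // (leq_trans _ lek).
by rewrite nth_default // expr0n gtn_eqF ?prime_gt0.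
Qed.

(* As [M] commutes with ['X], raising ['X - M] to the [p]-th power gives
   ['X^p - M ^+ p]; the identity is read off the second highest coefficients
   of the determinants. *)
Lemma mxtrace_pFrobenius (R : comNzRingType) (p n : nat) (M : 'M[R]_n) :
  p \in [pchar R] -> \tr (M ^+ p) = \tr M ^+ p.
Proof.
move=> pcharRp; have pr_p := pcharf_prime pcharRp.
case: n M => [|n] M.
  by rewrite /mxtrace !big_ord0 expr0n gtn_eqF ?prime_gt0.
have pcharMp : p \in [pchar 'M[{poly R}]_n.+1].
  have pcharPp : p \in [pchar {poly R}] by rewrite pchar_poly.
  by rewrite inE pr_p -(rmorph_nat (@scalar_mx {poly R} n.+1)) (pcharf0 pcharPp) rmorph0 eqxx.
have XpE : (char_poly_mx M) ^+ p = map_mx (comp_poly 'X^p) (char_poly_mx (M ^+ p)).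
  rewrite /char_poly_mx -(pFrobenius_autE pcharMp) pFrobenius_autB_comm; last first.
    exact: (esym (scalar_mxC _ _)).
  rewrite !pFrobenius_autE -(rmorphXn (map_mx (@polyC R))) -(rmorphXn (@scalar_mx _ n.+1)) /=.
  by apply/matrixP => i j; rewrite !mxE raddfB raddfMn /= comp_polyX comp_polyC.
have charp : char_poly M ^+ p = char_poly (M ^+ p) \Po 'X^p.
  rewrite /char_poly -det_map_mx -XpE.
  elim: p {XpE pcharRp pr_p pcharMp} => [|k IHk]; first by rewrite !expr0 det1.
  by rewrite !exprS det_mulmx IHk.
apply: oppr_inj; rewrite -char_poly_trace //.
have := coef_pFrobenius (char_poly M) n pcharRp.
rewrite charp coef_comp_poly_Xn ?prime_gt0 // dvdn_mull // mulnK ?prime_gt0 // => ->.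
rewrite -[X in _`_X]/(n.+1.-1) char_poly_trace //.
by rewrite -!(pFrobenius_autE pcharRp) rmorphN.
Qed.

(** * Denominators; the trace as a linear form and the embedding as a ring morphism *)

Lemma fracP (R : idomainType) (x : {fraction R}) :
  exists2 d : R, d != 0 & exists n : R, d%:F * x = n%:F.
Proof.
elim/quotW: x => x; exists x.2; first exact: denom_ratioP.
exists x.1; have d0 := denom_ratioP x.
rewrite -[LHS]/(FracField.mul _ _) !piE.
by apply/eqP; rewrite FracField.equivf_def /FracField.mulf !numden_Ratio ?oner_eq0 ?mul1r ?mulr1.
Qed.

Lemma traceK_is_scalar (F : fieldType) (K : fieldExtType {fraction {poly F}}) :
  scalar (@traceK F K).
Proof.
by move=> a x y; rewrite /traceK linearP /= passmx.mxof_linear linearP.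
Qed.
HB.instance Definition _ (F : fieldType) (K : fieldExtType {fraction {poly F}}) :=
  GRing.isSemilinear.Build {fraction {poly F}} K {fraction {poly F}} *%R (@traceK F K)
    (GRing.semilinear_linear (@traceK_is_scalar F K)).

HB.instance Definition _ (F : fieldType) (K : fieldExtType {fraction {poly F}}) :=
  GRing.RMorphism.copy (@embK F K)
    (in_alg K \o @FracField.tofrac {poly F}).

(** * Arithmetic of the integral closure [O] and of its ideals generated by polynomials *)

Section Integers.
Variables (F : fieldType) (K : fieldExtType {fraction {poly F}}).
Implicit Types (x y z : K) (a b B C D : {poly F}).
Local Notation emb := (embK K).

Lemma embK_inj : injective emb.
Proof.
move=> a b /eqP; rewrite -subr_eq0 -rmorphB scaler_eq0 oner_eq0 orbF.
by rewrite tofrac_eq0 subr_eq0 => /eqP.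
Qed.

Lemma embK_mul a x : emb a * x = a%:F *: x.
Proof. by rewrite /embK -scalerAl mul1r. Qed.

Lemma traceKZ c x : traceK (c *: x) = c * traceK x.
Proof. by rewrite -[c *: x]addr0 traceK_is_scalar raddf0 addr0. Qed.

Lemma integralKP x : integralK x <-> integralOver emb x.
Proof. by split=> [[p [mon_p px0]] | [p mon_p px0]]; exists p. Qed.

Lemma integralK_emb a : integralK (emb a).
Proof. exact/integralKP/integral_id. Qed.

Lemma integralK0 : integralK (0 : K).
Proof. exact/integralKP/integral0. Qed.

Lemma integralK1 : integralK (1 : K).
Proof. exact/integralKP/integral1. Qed.

Lemma integralKD x y : integralK x -> integralK y -> integralK (x + y).
Proof. by move=> /integralKP ix /integralKP iy; apply/integralKP/integral_add. Qed.

Lemma integralKN x : integralK x -> integralK (- x).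
Proof. by move=> /integralKP ix; apply/integralKP/integral_opp. Qed.

Lemma integralKB x y : integralK x -> integralK y -> integralK (x - y).
Proof. by move=> ix iy; apply/integralKD/integralKN. Qed.

Lemma integralKM x y : integralK x -> integralK y -> integralK (x * y).
Proof. by move=> /integralKP ix /integralKP iy; apply/integralKP/integral_mul. Qed.

Lemma integralKX x n : integralK x -> integralK (x ^+ n).
Proof.
by move=> ix; elim: n => [|n IHn]; [exact: integralK1|rewrite exprS; exact: integralKM].
Qed.

Lemma integralK_sum (I : Type) (r : seq I) (P : pred I) (f : I -> K) :
  (forall i, P i -> integralK (f i)) -> integralK (\sum_(i <- r | P i) f i).
Proof. by apply: big_ind; [exact: integralK0 | exact: integralKD]. Qed.

Lemma integralK_prod (I : Type) (r : seq I) (P : pred I) (f : I -> K) :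
  (forall i, P i -> integralK (f i)) -> integralK (\prod_(i <- r | P i) f i).
Proof. by apply: big_ind; [exact: integralK1 | exact: integralKM]. Qed.

(** Convertible with congruence: [congrK (emb B) x y] is [in_ideal B (x - y)], so congruences can be
    handled as ideal memberships. *)
Definition in_ideal B y := exists z, integralK z /\ y = emb B * z.

Lemma in_ideal_integral B y : in_ideal B y -> integralK y.
Proof. by move=> [z [iz ->]]; apply: integralKM => //; apply: integralK_emb. Qed.

Lemma in_ideal0 B : in_ideal B 0.
Proof. by exists 0; split; [exact: integralK0 | rewrite mulr0]. Qed.

Lemma in_idealD B x y : in_ideal B x -> in_ideal B y -> in_ideal B (x + y).
Proof.
move=> [u [iu ->]] [v [iv ->]]; exists (u + v); split; last by rewrite mulrDr.
exact: integralKD.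
Qed.

Lemma in_idealN B x : in_ideal B x -> in_ideal B (- x).
Proof. by move=> [u [iu ->]]; exists (- u); rewrite mulrN; split=> //; apply: integralKN. Qed.

Lemma in_idealB B x y : in_ideal B x -> in_ideal B y -> in_ideal B (x - y).
Proof. by move=> Bx By; apply/in_idealD/in_idealN. Qed.

Lemma in_idealMl B x y : integralK x -> in_ideal B y -> in_ideal B (x * y).
Proof.
by move=> ix [u [iu ->]]; exists (x * u); rewrite mulrCA; split=> //; apply: integralKM.
Qed.

Lemma in_ideal_sum B (I : Type) (r : seq I) (P : pred I) (f : I -> K) :
  (forall i, P i -> in_ideal B (f i)) -> in_ideal B (\sum_(i <- r | P i) f i).
Proof. by apply: big_ind; [exact: in_ideal0 | exact: in_idealD]. Qed.

Lemma in_ideal_emb B C z : integralK z -> B %| C -> in_ideal B (emb C * z).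
Proof.
move=> iz /dvdpP[h ->]; exists (emb h * z); split.
  by apply: integralKM => //; apply: integralK_emb.
by rewrite rmorphM mulrCA mulrA.
Qed.

Lemma coprimep_bezout B C : coprimep B C -> exists u v, u * B + v * C = 1.
Proof. by move=> /Bezout_eq1_coprimepP[[u v] /= uv]; exists u, v. Qed.

(** A Bezout relation [u * D + v * B = 1] splits [y] into [u D y], in the ideal by hypothesis, and
    [v B y]. *)
Lemma in_ideal_cancel B D y :
  coprimep D B -> integralK y -> in_ideal B (emb D * y) -> in_ideal B y.
Proof.
move=> /coprimep_bezout[u [v uv]] iy BDy.
rewrite -[y]mul1r -(rmorph1 emb) -uv rmorphD mulrDl; apply: in_idealD.
  by rewrite rmorphM -mulrA; apply: in_idealMl => //; apply: integralK_emb.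
by apply: in_ideal_emb => //; apply: dvdp_mull.
Qed.

(** With [y = B z], cancelling [B] modulo [C] puts [z] itself in the ideal of [C]. Congruences known
    for each irreducible factor of [g] are glued this way. *)
Lemma in_ideal_coprime B C y : coprimep B C ->
  in_ideal B y -> in_ideal C y -> in_ideal (B * C) y.
Proof.
move=> coBC [z [iz yBz]] Cy.
have [z' [iz' zCz']] : in_ideal C z by apply: (in_ideal_cancel coBC iz); rewrite -yBz.
by exists z'; rewrite rmorphM -mulrA -zCz'.
Qed.

(* The powers of [x] span a finitely generated [F[t]]-module. *)
Lemma traceK_powers_bounded x : integralK x ->
  exists2 D : {poly F}, D != 0 & forall n, exists h, D%:F * traceK (x ^+ n) = h%:F.
Proof.
move=> [p [mon_p /eqP px0]].
(* [D] is a common denominator for the traces of the first [size p] powers of [x]; division of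
   ['X^n] by the monic [p] reduces every power to these. *)
have [D nzD Dtr] : exists2 D : {poly F}, D != 0 &
    forall i, (i < size p)%N -> exists h, D%:F * traceK (x ^+ i) = h%:F.
  elim: (size p) => [|m [D nzD IHm]]; first by exists 1; rewrite ?oner_eq0.
  have [E nzE [h Eh]] := fracP (traceK (x ^+ m)).
  exists (D * E); rewrite ?mulf_neq0 // => i.
  rewrite ltnS leq_eqVlt => /predU1P[->|/IHm[h' Dh']].
    by exists (D * h); rewrite !rmorphM -mulrA Eh.
  by exists (E * h'); rewrite rmorphM mulrAC Dh' rmorphM mulrC.
exists D => // n; have := Pdiv.RingMonic.rdivp_eq mon_p 'X^n.
move/(congr1 (fun f => (map_poly emb f).[x])).
rewrite map_polyXn hornerXn rmorphD rmorphM hornerD hornerM px0 mulr0 add0r => ->.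
set r := Pdiv.Ring.rmodp _ _; have ltr : (size r <= size p)%N.
  by apply/ltnW/Pdiv.Ring.ltn_rmodpN0/monic_neq0.
have lep : (size (map_poly emb r) <= size p)%N := leq_trans (size_poly _ _) ltr.
rewrite (horner_coef_wide _ lep) raddf_sum mulr_sumr.
apply: (big_ind (fun z : {fraction {poly F}} => exists h : {poly F}, z = h%:F)).
- by exists 0; rewrite rmorph0.
- by move=> _ _ [h ->] [h' ->]; exists (h + h'); rewrite rmorphD.
move=> i _; have [h Dh] := Dtr i (ltn_ord i).
exists (r`_i * h); rewrite coef_map embK_mul /= traceKZ mulrCA Dh.
by rewrite rmorphM.
Qed.

End Integers.

(** * Integrality of the trace *)

Section Frob.
Variables (F : fieldType) (K : fieldExtType {fraction {poly F}}) (p : nat).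
Hypothesis pcharFp : p \in [pchar F].
Implicit Types (x y z : K) (a b B C D : {poly F}).
Local Notation emb := (embK K).

Let pr_p : prime p := pcharf_prime pcharFp.

Lemma pchar_frac : p \in [pchar {fraction {poly F}}].
Proof. by apply: (rmorph_pchar (@FracField.tofrac {poly F})); rewrite pchar_poly. Qed.

Lemma pchar_ext : p \in [pchar K].
Proof. exact: (rmorph_pchar (in_alg K) pchar_frac). Qed.

(** Multiplication by [x ^+ p] is the [p]-th iterate of multiplication by [x], so its matrix is a
    [p]-th power and [mxtrace_pFrobenius] applies. *)
Lemma traceK_pFrobenius x : traceK (x ^+ p) = traceK x ^+ p.
Proof.
have vbP := vbasisP {:K}.
rewrite /traceK -(mxtrace_pFrobenius _ pchar_frac); congr (\tr _).
elim: p => [|n IHn].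
  rewrite !expr0 -[RHS](passmx.mxof1 (basis_free vbP)); congr passmx.mxof.
  by apply/lfunP => y; rewrite !lfunE /= mulr1.
rewrite !exprSr -IHn -[RHS](passmx.mxof_comp (vbasis {:K}) (vbasis {:K}) vbP).
congr (passmx.mxof _ _); apply/lfunP => y; rewrite comp_lfunE !lfunE /=.
by rewrite mulrA.
Qed.

Lemma traceK_pFrobenius_iter x e : traceK (x ^+ (p ^ e)) = traceK x ^+ (p ^ e).
Proof.
elim: e => [|e IHe]; first by rewrite !expr1.
by rewrite expnSr !exprM traceK_pFrobenius IHe.
Qed.

(* If [z = u / v] in lowest terms, every [v ^+ (p ^ e)] divides [D], so [v] is a unit. *)
Lemma bounded_powers_poly (z : {fraction {poly F}}) D : D != 0 ->
  (forall e, exists h : {poly F}, D%:F * z ^+ (p ^ e) = h%:F) ->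
  exists h : {poly F}, z = h%:F.
Proof.
move=> nzD Dz; have [w nzw [n wz]] := fracP z.
pose c := gcdp n w; have nzc : c != 0 by rewrite gcdp_eq0 negb_and nzw orbT.
pose u := n %/ c; pose v := w %/ c.
have nE : n = u * c by rewrite divpK ?dvdp_gcdl.
have wE : w = v * c by rewrite divpK ?dvdp_gcdr.
have nzv : v != 0 by apply: contraNneq nzw => v0; rewrite wE v0 mul0r.
have vz : v%:F * z = u%:F.
  apply: (mulIf (_ : c%:F != 0)); first by rewrite tofrac_eq0.
  by rewrite mulrAC -!rmorphM -wE -nE.
have co_uv : coprimep u v by rewrite coprimep_div_gcd // nzw orbT.
have v_dvd e : v ^+ (p ^ e) %| D.
  have [h Dh] := Dz e.
  rewrite -(@Gauss_dvdpl _ _ (u ^+ (p ^ e))); last first.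
    by rewrite coprimep_expl // coprimep_expr // coprimep_sym.
  apply/dvdpP; exists h; apply/eqP; rewrite -tofrac_eq; apply/eqP.
  by rewrite !rmorphM !rmorphXn /= -vz -Dh exprMn -mulrA (mulrC (v%:F ^+ _)).
have [s1|s1] := leqP (size v) 1.
  have [k vk] : exists k, v = k%:P by exists v`_0; apply: size1_polyC.
  have nzk : k != 0 by apply: contraNneq nzv => k0; rewrite vk k0.
  exists (k^-1%:P * u); rewrite rmorphM /= -vz mulrA -rmorphM /= vk -polyCM mulVf //.
  by rewrite rmorph1 mul1r.
(* A nonconstant [v] is excluded by [e = size D]: the degree of [v ^+ (p ^ e)] is at least [p ^ e],
   which exceeds [size D]. *)
have := dvdp_leq nzD (v_dvd (size D)); rewrite leqNgt => /negP[].
have ltD : (size D < p ^ size D)%N by apply/ltn_expl/prime_gt1.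
apply: leq_trans ltD (leq_trans _ (leq_pred _)).
by rewrite size_exp leq_pmull // -ltnS (ltn_predK s1).
Qed.

Lemma traceK_integral x : integralK x -> exists h : {poly F}, traceK x = h%:F.
Proof.
move=> ix; have [D nzD Dx] := traceK_powers_bounded ix.
apply: (bounded_powers_poly nzD) => e; rewrite -traceK_pFrobenius_iter.
exact: Dx.
Qed.

End Frob.

(** * Determinants and discriminants modulo a polynomial *)

Lemma det_compatible (R : comNzRingType) (r : R -> R -> Prop) (n : nat) (M N : 'M[R]_n) :
    r 0 0 -> r 1 1 -> r (-1) (-1) ->
    (forall x y z t, r x y -> r z t -> r (x + z) (y + t)) ->
    (forall x y z t, r x y -> r z t -> r (x * z) (y * t)) ->
    (forall i j, r (M i j) (N i j)) -> r (\det M) (\det N).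
Proof.
(* The Leibniz expansion uses only sums, products and signs. A general [r] covers both divisibility
   in [{poly F}] and congruence between integers of [K]. *)
move=> r0 r1 rN1 rD rM rMN; apply: (big_ind2 r) => // s _.
apply: (rM); first by case: (perm.odd_perm s); rewrite ?expr0 ?expr1.
exact: (big_ind2 r).
Qed.

Lemma det_dvdp (F : fieldType) (B : {poly F}) (n : nat) (M N : 'M[{poly F}]_n) :
  (forall i j, B %| M i j - N i j) -> B %| \det M - \det N.
Proof.
apply: (det_compatible (r := fun a b => B %| a - b)); rewrite ?subrr ?dvdp0 //.
  by move=> x y z t xy zt; rewrite opprD addrACA dvdp_add.
move=> x y z t xy zt; rewrite -[x](subrK y) mulrDl -addrA -mulrBr.
by apply: dvdp_add; [apply: dvdp_mulr | apply: dvdp_mull].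
Qed.

Section Discriminant.
Variables (F : fieldType) (K : fieldExtType {fraction {poly F}}) (p : nat).
Hypothesis pcharFp : p \in [pchar F].
Implicit Types (y z : K) (a b B C D : {poly F}).
Local Notation emb := (embK K).
Local Notation tofrac := (@FracField.tofrac {poly F}).

Lemma traceK_in_ideal B y : in_ideal B y -> exists h : {poly F}, traceK y = (B * h)%:F.
Proof.
move=> [z [iz ->]]; have [h zh] := traceK_integral pcharFp iz.
by exists h; rewrite embK_mul traceKZ zh rmorphM.
Qed.

Variable d : nat.
Implicit Types x w : 'I_d -> K.

Lemma traceK_gram x : (forall i, integralK (x i)) ->
  exists M : 'M[{poly F}]_d,
    map_mx tofrac M = \matrix_(i, j) traceK (x i * x j).
Proof.
move=> ix.
have /fin_all_exists[f fP] (ij : 'I_d * 'I_d) :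
    exists h : {poly F}, traceK (x ij.1 * x ij.2) = h%:F.
  by apply: (traceK_integral pcharFp); apply: integralKM.
exists (\matrix_(i, j) f (i, j)); apply/matrixP => i j.
by rewrite !mxE (fP (i, j)).
Qed.

Lemma discK_integral x : (forall i, integralK (x i)) ->
  exists D : {poly F}, discK x = D%:F.
Proof.
by move=> /traceK_gram[M gramE]; exists (\det M); rewrite /discK -gramE det_map_mx.
Qed.

(** The products [x i * x j] and [w i * w j] differ by an element of the ideal, whose trace is a
    multiple of [B]; hence the Gram matrices are congruent entry by entry. *)
Lemma discK_in_ideal B x w (D E : {poly F}) : (forall i, integralK (x i)) ->
    (forall i, integralK (w i)) -> (forall i, in_ideal B (x i - w i)) ->
  discK x = D%:F -> discK w = E%:F -> B %| D - E.
Proof.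
move=> ix iw Bxw; have [M gM] := traceK_gram ix; have [N gN] := traceK_gram iw.
rewrite /discK -gM -gN !det_map_mx.
move=> /eqP; rewrite tofrac_eq => /eqP <- /eqP; rewrite tofrac_eq => /eqP <-.
apply: det_dvdp => i j; have /traceK_in_ideal[h trh] : in_ideal B (x i * x j - w i * w j).
  rewrite -[x i](subrK (w i)) mulrDl -addrA -mulrBr mulrC.
  by apply: in_idealD; apply: in_idealMl.
suff -> : M i j - N i j = B * h by rewrite dvdp_mulr.
apply/eqP; rewrite -tofrac_eq rmorphB /= -trh raddfB /=.
by move/matrixP/(_ i j): gM; move/matrixP/(_ i j): gN; rewrite !mxE => -> ->.
Qed.

(** * Coordinates with respect to a family of discriminant [D] *)

Section Frame.
Variables (x : 'I_d -> K) (D : {poly F}).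
Hypotheses (ix : forall i, integralK (x i)) (discxD : discK x = D%:F).

Let gram := \matrix_(i < d, j < d) traceK (x i * x j).

Let gramP : exists2 M : 'M[{poly F}]_d, map_mx tofrac M = gram & \det M = D.
Proof.
have [M gM] := traceK_gram ix; exists M => //.
by apply/eqP; rewrite -tofrac_eq -det_map_mx gM -/(discK x) discxD.
Qed.

Let row_gram (b : 'rV_d) :
  b *m gram = \row_j traceK ((\sum_i b 0 i *: x i) * x j).
Proof.
apply/rowP => j; rewrite !mxE mulr_suml raddf_sum /=.
by apply: eq_bigr => i _; rewrite !mxE -scalerAl traceKZ.
Qed.

(** Independence modulo [B]: pairing the combination with each [x j] gives [a M = B s] for the Gram
    matrix [M], and the adjugate of [M] turns this into [B %| D * a i]. *)
Lemma frame_dvdp B (a : 'I_d -> {poly F}) : coprimep D B ->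
  in_ideal B (\sum_i emb (a i) * x i) -> forall i, B %| a i.
Proof.
move=> coDB Bax; have [M gM detM] := gramP.
have /fin_all_exists[s sP] j :
    exists h : {poly F}, traceK ((\sum_i emb (a i) * x i) * x j) = (B * h)%:F.
  by apply: traceK_in_ideal; rewrite mulrC; apply: in_idealMl.
have aM : (\row_i a i) *m M = B *: \row_j s j.
  suff /rowP aMfrac : map_mx tofrac ((\row_i a i) *m M) = map_mx tofrac (B *: \row_j s j).
    by apply/rowP => j; apply/eqP; rewrite -tofrac_eq; move: (aMfrac j); rewrite !mxE => ->.
  rewrite map_mxM gM row_gram map_mxZ.
  apply/rowP => j; rewrite !mxE -[RHS]rmorphM /= -sP.
  by congr (traceK (_ * _)); apply: eq_bigr => i _; rewrite !mxE embK_mul.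
move=> i; rewrite -(@Gauss_dvdpr _ _ D) 1?coprimep_sym //.
have := congr1 (fun v => (v *m \adj M) 0 i) aM.
rewrite -mulmxA mul_mx_adj detM mul_mx_scalar -scalemxAl !mxE => ->.
exact: dvdp_mulr.
Qed.

Hypotheses (dimK : \dim {:K} = d) (nzD : D != 0).

Lemma frame_expand y : exists b : 'rV_d, y = \sum_i b 0 i *: x i.
Proof.
have unitG : gram \in unitmx by rewrite unitmxE unitfE -/(discK x) discxD tofrac_eq0.
pose e := [tuple x i | i < d].
have eE (i : 'I_d) : e`_i = x i by rewrite -tnth_nth tnth_mktuple.
have free_e : free e.
  apply/freeP => k ke0 i; have := row_gram (\row_i k i).
  rewrite (_ : \sum_i _ = 0); last first.
    by rewrite -[RHS]ke0; apply: eq_bigr => j _; rewrite mxE eE.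
  have -> : \row_j traceK (0 * x j) = 0 by apply/rowP => j; rewrite !mxE mul0r raddf0.
  move=> /(congr1 (mulmx^~ (invmx gram))); rewrite mulmxK // mul0mx.
  by move/rowP/(_ i); rewrite !mxE.
have basis_e : basis_of {:K} e by rewrite basisEfree free_e subvf size_tuple dimK /=.
exists (\row_i coord e i y).
rewrite [LHS](coord_basis basis_e (memvf y)).
by apply: eq_bigr => i _; rewrite mxE eE.
Qed.

(** Cramer's rule for the Gram matrix. With [B = 1] it bounds the denominators of integers by [D];
    for [B] prime to [D] it makes the trace form nondegenerate modulo [B]. *)
Lemma frame_cramer B y (t : 'I_d -> {poly F}) :
    (forall j, traceK (y * x j) = (B * t j)%:F) ->
  exists c : 'I_d -> {poly F}, emb D * y = emb B * \sum_i emb (c i) * x i.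
Proof.
move=> tP; have [M gM detM] := gramP; have [b yb] := frame_expand y.
have bG : b *m gram = map_mx tofrac (B *: \row_j t j).
  by rewrite row_gram -yb; apply/rowP => j; rewrite !mxE tP.
exists (fun i => ((\row_j t j) *m \adj M) 0 i).
have Db i : D%:F * b 0 i = (B * ((\row_j t j) *m \adj M) 0 i)%:F.
  have := congr1 (fun v => (v *m \adj gram) 0 i) bG.
  rewrite -mulmxA mul_mx_adj -/(discK x) discxD mul_mx_scalar mxE => ->.
  by rewrite -gM -map_mx_adj -map_mxM -scalemxAl !mxE.
rewrite {1}yb !mulr_sumr; apply: eq_bigr => i _.
by rewrite mulrA -rmorphM !embK_mul scalerA Db.
Qed.

Lemma frame_spans y : integralK y ->
  exists c : 'I_d -> {poly F}, emb D * y = \sum_i emb (c i) * x i.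
Proof.
move=> iy; have /fin_all_exists[t tP] j : exists h : {poly F}, traceK (y * x j) = (1 * h)%:F.
  have [h yh] := traceK_integral pcharFp (integralKM iy (ix j)).
  by exists h; rewrite mul1r.
by have [c Dy] := frame_cramer tP; exists c; rewrite Dy rmorph1 mul1r.
Qed.

Lemma frame_in_ideal B y : coprimep D B -> integralK y ->
  (forall j, exists h : {poly F}, traceK (y * x j) = (B * h)%:F) -> in_ideal B y.
Proof.
move=> coDB iy /fin_all_exists[t tP]; have [c Dy] := frame_cramer tP.
apply: (in_ideal_cancel coDB iy); rewrite Dy; eexists; split; last by [].
by apply: integralK_sum => i _; apply: integralKM => //; apply: integralK_emb.
Qed.

(* A nilpotent element mod [P] has trace zero mod [P] because the trace commutes
   with the Frobenius map; as this applies to all [y * x j], nondegeneracy of the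
   trace form mod [P] gives [y = 0] mod [P]. *)
Lemma frame_reduced P y m : irreducible_poly P -> coprimep D P -> integralK y ->
  in_ideal P (y ^+ m) -> in_ideal P y.
Proof.
move=> irrP coDP iy Pym; apply: (frame_in_ideal coDP iy) => j.
have [t tE] := traceK_integral pcharFp (integralKM iy (ix j)).
(* Since [p ^ m] exceeds [m], the power [(y * x j) ^+ (p ^ m)] is a multiple of [y ^+ m]; as a power
   of [p], this exponent also passes through the trace. *)
have ltm : (m < p ^ m)%N by apply/ltn_expl/prime_gt1/(pcharf_prime pcharFp).
have : in_ideal P ((y * x j) ^+ (p ^ m)).
  rewrite exprMn -(subnK (ltnW ltm)) exprD mulrC mulrA.
  by apply: in_idealMl => //; apply: integralKM; apply: integralKX.
move=> /traceK_in_ideal[h]; rewrite (traceK_pFrobenius_iter pcharFp) tE -rmorphXn.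
move=> /eqP; rewrite tofrac_eq => /eqP tPh.
suff /dvdpP[k ->] : P %| t by exists k; rewrite mulrC.
apply: contraT => ndvd; have /negP[] : ~~ (P %| t ^+ (p ^ m)).
  rewrite -irreducible_poly_coprime // coprimep_expr //.
  by rewrite irreducible_poly_coprime.
by rewrite tPh dvdp_mulr.
Qed.

End Frame.
End Discriminant.

(** * Fermat congruences and the Moore determinant *)

Lemma irreducible_dvdp_card (F : finFieldType) (P c : {poly F}) :
  irreducible_poly P -> P %| c ^+ (#|F| ^ pdeg P) - c.
Proof.
move=> irrP; have nzP := irredp_neq0 irrP.
(* The quotient field is built on a monic modulus, so [P] is replaced by its monic associate. That
   field has [#|F| ^ pdeg P] elements. *)
pose M := (lead_coef P)^-1 *: P.
have nzl : (lead_coef P)^-1 != 0 by rewrite invr_eq0 lead_coef_eq0.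
have MP : M %= P by apply: eqp_scale.
have monM : M \is monic by rewrite monicE lead_coefZ mulVf // lead_coef_eq0.
have irrM : irreducible_poly M.
  split=> [|r r1 rM]; first by rewrite (eqp_size MP) irrP.1.
  apply: eqp_trans (irrP.2 r r1 _) _; last by rewrite eqp_sym.
  by rewrite -(eqp_dvdr _ MP).
have mi : monic_irreducible_poly M by split.
have := expf_card (in_qpoly M c : {poly %/ M with mi}).
rewrite card_qfpoly (eqp_size MP) -/(pdeg P) => ME.
rewrite -(eqp_dvdl _ MP) /dvdp.
have /(congr1 val) /= : in_qpoly M (c ^+ (#|F| ^ pdeg P) - c) = 0.
  by rewrite rmorphB rmorphXn; apply/eqP; rewrite subr_eq0; apply/eqP.
by rewrite /mk_monic (irrM.1) monM /= -Pdiv.IdomainMonic.modpE // => ->.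
Qed.

(** By induction on [s]: [a ^+ (m ^ s.+1) - a] is [(a ^+ (m ^ s)) ^+ m - a ^+ m] plus [a ^+ m - a],
    and the first difference is a multiple of [a ^+ (m ^ s) - a]. The predicate [S] will be
    integrality, which keeps the cofactor [w] in [O]. *)
Lemma subr_expn_dvd (R : comNzRingType) (a : R) (m s : nat) (S : R -> Prop) :
    S 0 -> S 1 -> (forall x y, S x -> S y -> S (x + y)) ->
    (forall x y, S x -> S y -> S (x * y)) -> S a ->
  exists2 w, S w & a ^+ (m ^ s) - a = (a ^+ m - a) * w.
Proof.
move=> S0 S1 SD SM Sa; have SX x n : S x -> S (x ^+ n).
  by move=> Sx; elim: n => [|n IHn]; rewrite ?expr0 // exprS; apply: SM.
elim: s => [|s [w Sw IHs]]; first by exists 0; rewrite ?expr1 ?subrr ?mulr0.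
exists (w * (\sum_(i < m) (a ^+ (m ^ s)) ^+ (m.-1 - i) * a ^+ i) + 1).
  apply: (SD) => //; apply: (SM) => //; apply: (big_ind S) => // i _.
  by apply: (SM); do ?apply: (SX).
by rewrite mulrDr mulr1 mulrA -IHs -subrXX expnSr exprM addrA subrK.
Qed.

Section Moore.
Variables (F : finFieldType) (K : fieldExtType {fraction {poly F}}).
Variables (d : nat) (x : 'I_d -> K) (D : {poly F}).
Hypotheses (ix : forall i, integralK (x i)) (discxD : discK x = D%:F).
Hypotheses (dimK : \dim {:K} = d) (nzD : D != 0).
Local Notation emb := (embK K).

Lemma expnat_card_sum e (I : Type) (r : seq I) (P : pred I) (f : I -> K) :
  (\sum_(i <- r | P i) f i) ^+ (#|F| ^ e) = \sum_(i <- r | P i) f i ^+ (#|F| ^ e).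
Proof.
have q_gt0 : (0 < #|F| ^ e)%N by rewrite expn_gt0 (ltnW (card_finNzRing_gt1 F)).
apply: (big_morph (fun z => z ^+ _)) => [u v|]; last first.
  by rewrite expr0n gtn_eqF.
apply: exprDn_pchar; have [p pr_p pcharFp] := finPcharP F.
rewrite (eq_pnat _ (pcharf_eq (pchar_ext K pcharFp))) pnatX.
by rewrite (card_pprimeChar pcharFp) pnatX pnat_id.
Qed.

Lemma expnat_cardB e (y z : K) :
  (y - z) ^+ (#|F| ^ e) = y ^+ (#|F| ^ e) - z ^+ (#|F| ^ e).
Proof.
have q_gt0 : (0 < #|F| ^ e)%N by rewrite expn_gt0 (ltnW (card_finNzRing_gt1 F)).
apply: (addIr (z ^+ (#|F| ^ e))); rewrite subrK.
by have := expnat_card_sum e [:: y - z; z] xpredT id; rewrite !big_cons !big_nil !addr0 subrK.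
Qed.

(* Modulo [P] the matrix of the [a ^+ (j * #|P| ^ i)], [0 <= i, j <= d], factors through
   a space of dimension [d] because [c ^+ #|P| = c] for [c] in [F[t]]. Its determinant
   is both a Moore determinant of the powers of [a] and a Vandermonde determinant. *)
Lemma frobenius_Vandermonde (P : {poly F}) (a : K) :
    irreducible_poly P -> coprimep D P -> integralK a ->
  in_ideal P (\prod_(i < d.+1) \prod_(j < d.+1 | (i < j)%N)
    (a ^+ ((#|F| ^ pdeg P) ^ j) - a ^+ ((#|F| ^ pdeg P) ^ i))).
Proof.
move=> irrP coDP ia; have [p pr_p pcharFp] := finPcharP F.
pose Q i := ((#|F| ^ pdeg P) ^ i)%N.
have /fin_all_exists[c cP] (j : 'I_d.+1) :
    exists c : 'I_d -> {poly F}, emb D * a ^+ j = \sum_l emb (c l) * x l.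
  by apply: (frame_spans pcharFp ix discxD dimK nzD); apply: integralKX.
pose V := Vandermonde d.+1 (\row_i a ^+ Q i) : 'M_d.+1.
(* Scaling column [i] by [emb D ^+ Q i] makes its entries the [Q i]-th powers of the
   [emb D * a ^+ j], which are polynomial combinations of the [x l]. *)
pose W := V *m diag_mx (\row_(i < d.+1) emb D ^+ Q i).
pose N := \matrix_(j < d.+1, l < d) emb (c j l) *m \matrix_(l < d, i < d.+1) x l ^+ Q i.
have detN : \det N = 0.
  apply/eqP; rewrite -[_ == 0]negbK -unitfE -unitmxE; apply/negP => /mxrank_unit rN.
  have := leq_trans (mxrankM_maxl _ _) (rank_leq_col (\matrix_(j < d.+1, l < d) emb (c j l))).
  by move=> /(_ _ (\matrix_(l < d, i < d.+1) x l ^+ Q i)); rewrite -/N rN ltnn.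
have WN i j : in_ideal P (W j i - N j i).
  have -> : W j i = (emb D * a ^+ j) ^+ Q i.
    by rewrite /W mul_mx_diag !mxE exprMn mulrC -!exprM mulnC.
  rewrite cP /N mxE /Q -expnM expnat_card_sum -sumrB; apply: in_ideal_sum => l _.
  rewrite !mxE -expnM exprMn -mulrBl mulrC; apply: in_idealMl; first exact: integralKX.
  rewrite -rmorphXn -rmorphB /= -[embK _ _]mulr1; apply: in_ideal_emb; first exact: integralK1.
  elim: (i : nat) => [|k IHk]; first by rewrite muln0 expr1 subrr dvdp0.
  rewrite mulnS addnC expnD exprM -(subrK (c j l ^+ (#|F| ^ (pdeg P * k))) (_ ^+ _)).
  by rewrite -addrA; apply: dvdp_add => //; apply: irreducible_dvdp_card.
have iW i j : integralK (W i j).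
  rewrite /W mul_mx_diag !mxE; apply: integralKM; do ?apply: integralKX => //.
  exact: integralK_emb.
have iN i j : integralK (N i j).
  rewrite -(subKr (W i j) (N i j)); apply: integralKB; first exact: iW.
  exact/in_ideal_integral/WN.
have : in_ideal P (\det W - \det N).
  suff [] : [/\ integralK (\det W), integralK (\det N) & in_ideal P (\det W - \det N)] by [].
  (* Congruence modulo [P] respects products only between integers, so the relation carries
     integrality along. *)
  apply: (@det_compatible _ (fun u v => [/\ integralK u, integralK v & in_ideal P (u - v)])).
  - by split; rewrite ?subrr; [exact: integralK0 | exact: integralK0 | exact: in_ideal0].
  - by split; rewrite ?subrr; [exact: integralK1 | exact: integralK1 | exact: in_ideal0].
  - by split; rewrite ?subrr; [| | exact: in_ideal0]; apply/integralKN/integralK1.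
  - move=> y z u v [iy iz Pyz] [iu iv Puv]; split; do ?exact: integralKD.
    by rewrite opprD addrACA; apply: in_idealD.
  - move=> y z u v [iy iz Pyz] [iu iv Puv]; split; do ?exact: integralKM.
    rewrite -[y](subrK z) mulrDl -addrA -mulrBr mulrC.
    by apply: in_idealD; apply: in_idealMl.
  - by move=> i j; split; [exact: iW | exact: iN | exact: WN].
rewrite detN subr0 det_mulmx det_Vandermonde det_diag mulrC.
have -> : \prod_i (\row_(i < d.+1) emb D ^+ Q i) 0 i = emb (\prod_(i < d.+1) D ^+ Q i).
  by rewrite rmorph_prod; apply: eq_bigr => i _; rewrite mxE rmorphXn.
have -> : \prod_(i < d.+1) \prod_(j < d.+1 | (i < j)%N)
      ((\row_i a ^+ Q i) 0 j - (\row_i a ^+ Q i) 0 i) =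
    \prod_(i < d.+1) \prod_(j < d.+1 | (i < j)%N) (a ^+ Q j - a ^+ Q i).
  by apply: eq_bigr => i _; apply: eq_bigr => j _; rewrite !mxE.
(* The scaling factors are prime to [P] and can be removed again. *)
apply: in_ideal_cancel.
  apply: (big_ind (fun u => coprimep u P)); first exact: coprime1p.
    by move=> u v coP1 coP2; rewrite coprimepMl coP1.
  by move=> i _; apply: coprimep_expl.
apply: integralK_prod => i _; apply: integralK_prod => j _.
by apply: integralKB; apply: integralKX.
Qed.

End Moore.

(** * Square-free polynomials, one irreducible factor at a time *)

Lemma irreducible_factor (F : finFieldType) (h : {poly F}) :
  (1 < size h)%N -> exists2 P, irreducible_poly P & P %| h.
Proof.
elim: {h}(size h) {-2}h (leqnn (size h)) => [|n IHn] h; first by case: (size h).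
move=> leh h1; have [/irreducibleP irrh|] := boolP (irreducibleb h); first by exists h.
(* [irreducibleb] tests the finitely many polynomials of smaller size, so its failure provides a
   proper nonconstant divisor [r]. *)
rewrite /irreducibleb h1 => /forallPn[r]; rewrite negb_imply -ltnNge => /andP[rh r1].
have nzh : h != 0 by rewrite -size_poly_gt0 (ltn_trans _ h1).
have {}rh : (r : {poly F}) %| h by rewrite Pdiv.Field.dvdpE.
have ltrh : (size r < size h)%N by rewrite (leq_ltn_trans (size_npoly r)) // ltn_predL ltnW.
have [P irrP Pr] := IHn r (leq_trans ltrh leh) r1.
by exists P; last apply: dvdp_trans Pr rh.
Qed.

(** Square-freeness makes each irreducible factor coprime to the remaining cofactor. The induction
    starts at nonzero constants because [g] is a product of irreducibles only up to a unit. *)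
Lemma squarefree_ind (F : finFieldType) (g : {poly F}) (T : {poly F} -> Prop) :
    squarefree_poly g -> (forall u : {poly F}, size u = 1%N -> T u) ->
    (forall P h, irreducible_poly P -> P %| g -> coprimep P h -> T h -> T (P * h)) ->
  T g.
Proof.
move=> [nzg sqg] T1 TM.
suff Tdvd n (h : {poly F}) : (size h <= n)%N -> h %| g -> T h by exact: Tdvd.
elim: n h => [|n IHn] h leh hg; have nzh := dvdpN0 hg nzg.
  by rewrite leqNgt size_poly_gt0 nzh in leh.
have [h1|h1] := leqP (size h) 1.
  by apply: T1; apply/eqP; rewrite eqn_leq h1 size_poly_gt0.
have [P irrP Ph] := irreducible_factor h1.
move: hg nzh leh; case/dvdpP: Ph => k ->; rewrite mulrC => hg nzh leh.
have Pg : P %| g by apply: dvdp_trans hg; apply: dvdp_mulr.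
apply: TM => //.
  rewrite irreducible_poly_coprime //; apply/negP => Pk.
  by apply: (sqg P irrP.1); apply: dvdp_trans hg; apply: dvdp_mul.
move: nzh; rewrite mulf_eq0 negb_or => /andP[nzP nzk].
apply: IHn; last by apply: dvdp_trans hg; apply: dvdp_mull.
move: leh; rewrite size_mul //; have := irrP.1.
by case: (size P) => [|[|m]] // _; rewrite !addSn ltnS; apply/leq_trans/leq_addl.
Qed.

Lemma coprimep_congr (F : fieldType) (B D E : {poly F}) :
  B %| D - E -> coprimep E B -> coprimep D B.
Proof.
move=> /dvdpP[k DE]; rewrite -[D](subrK E) DE ![coprimep _ B]coprimep_sym.
by rewrite coprimep_addl_mul.
Qed.

(** * The ring [O / g O]: power map, cardinality, zero divisors, and existence of a suitable
    family *)

Section Main.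
Variables (F : finFieldType) (K : fieldExtType {fraction {poly F}}).
Local Notation emb := (embK K).
Implicit Types (P B D : {poly F}).

Section Frame.
Variables (d : nat) (x : 'I_d -> K) (D : {poly F}).
Hypotheses (ix : forall i, integralK (x i)) (discxD : discK x = D%:F).
Hypotheses (dimK : \dim {:K} = d) (nzD : D != 0).

Lemma expr_card_in_ideal P (m : nat) (a : K) :
    irreducible_poly P -> coprimep D P -> integralK a ->
    (forall i, (1 <= i <= d)%N -> (i * pdeg P %| m)%N) ->
  in_ideal P (a ^+ (#|F| ^ m) - a).
Proof.
move=> irrP coDP ia degP; have [p pr_p pcharFp] := finPcharP F.
set e := a ^+ _ - a; pose Q i := ((#|F| ^ pdeg P) ^ i)%N.
suff [n [w [iw Vw]]] : exists n w, integralK w /\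
    \prod_(i < d.+1) \prod_(j < d.+1 | (i < j)%N) (a ^+ Q j - a ^+ Q i) * w = e ^+ n.
  apply: (frame_reduced pcharFp ix discxD dimK nzD (m := n)) => //.
    by apply: integralKB => //; apply: integralKX.
  rewrite -Vw mulrC; apply: in_idealMl => //.
  exact: (frobenius_Vandermonde ix discxD).
(* Divisors in [O] of some power of [e] are closed under products, so each factor of the Vandermonde
   product can be treated alone. *)
pose dvd_pow u := exists n w, integralK w /\ u * w = e ^+ n.
have dvd_pow1 : dvd_pow 1 by exists 0%N, 1; rewrite mul1r; split=> //; exact: integralK1.
have dvd_powM u v : dvd_pow u -> dvd_pow v -> dvd_pow (u * v).
  move=> [n [w [iw uw]]] [n' [w' [iw' vw']]]; exists (n + n')%N, (w * w').
  by rewrite exprD -uw -vw' mulrACA; split=> //; apply: integralKM.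
apply: (big_ind dvd_pow) => // i _; apply: (big_ind dvd_pow) => // j ltij.
(* Rigidity is applied to the index [j - i], which lies between 1 and [d]. *)
have [s ms] : exists s, m = (pdeg P * (j - i) * s)%N.
  have /degP/dvdnP[s ms] : (1 <= j - i <= d)%N.
    by rewrite subn_gt0 ltij (leq_trans (leq_subr _ _)) // -ltnS.
  by exists s; rewrite ms mulnC [(_ * pdeg P)%N]mulnC.
have [w iw aw] := @subr_expn_dvd _ a (#|F| ^ (pdeg P * (j - i))) s (@integralK F K)
  (integralK0 K) (integralK1 K) (@integralKD _ K) (@integralKM _ K) ia.
exists (Q i), (w ^+ Q i); split; first exact: integralKX.
have -> : a ^+ Q j - a ^+ Q i = (a ^+ (#|F| ^ (pdeg P * (j - i))) - a) ^+ Q i.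
  rewrite /Q -!expnM expnat_cardB -exprM -expnD -mulnDr subnK //.
  exact: ltnW.
by rewrite -exprMn -aw -expnM -ms.
Qed.

Variable g : {poly F}.
Hypothesis coDg : coprimep D g.

(** Representatives are the combinations of the [x i] with coefficients of degree below [pdeg g],
    encoded as matrices over [F]. They are distinct by [frame_dvdp] and exhaust the classes by
    [frame_spans]. *)
Lemma frame_quot_card : g != 0 -> quot_card (emb g) (#|F| ^ (d * pdeg g)).
Proof.
move=> nzg; have [p pr_p pcharFp] := finPcharP F; set N := (_ ^ _)%N.
pose rep (M : 'M[F]_(d, pdeg g)) := \sum_i emb (rVpoly (row i M)) * x i.
have [e [szE uniqE memE]] : exists e : seq 'M[F]_(d, pdeg g),
    [/\ size e = N, uniq e & forall M, M \in e].
  exists (enum {: 'M[F]_(d, pdeg g)}); rewrite -cardT card_mx enum_uniq.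
  by split=> // M; rewrite mem_enum.
exists (map rep e); split; first by rewrite size_map.
have sg : (pdeg g < size g)%N by rewrite ltn_predL size_poly_gt0.
split; [|split].
- move=> i iN; rewrite (nth_map 0) ?szE //; apply: integralK_sum => k _.
  by apply: integralKM => //; apply: integralK_emb.
- move=> i j iN jN; rewrite !(nth_map 0) ?szE //.
  set M := nth _ _ i; set M' := nth _ _ j => gMM'.
  suff MM' : M = M'.
    by apply/eqP; rewrite -(nth_uniq 0 _ _ uniqE) ?szE //; apply/eqP.
  have : in_ideal g (\sum_k emb (rVpoly (row k M) - rVpoly (row k M')) * x k).
    suff -> : \sum_k emb (rVpoly (row k M) - rVpoly (row k M')) * x k = rep M - rep M' by [].
    by rewrite -sumrB; apply: eq_bigr => k _; rewrite rmorphB mulrBl.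
  move=> /(frame_dvdp pcharFp ix discxD coDg) gM; apply/row_matrixP => k.
  apply: (can_inj (@rVpolyK _ _)); apply/eqP; rewrite -subr_eq0; apply: contraT => nz.
  have := dvdp_leq nz (gM k); rewrite leqNgt => /negP[].
  apply: leq_ltn_trans sg; apply: leq_trans (size_polyD _ _) _.
  by rewrite size_polyN geq_max !size_poly.
- move=> y iy; have [c Dy] := frame_spans pcharFp ix discxD dimK nzD iy.
  have [u [v uv]] := coprimep_bezout coDg.
  (* As [u] inverts [D] modulo [g], the coordinates of [y] modulo [g] are the [u * c i]. *)
  pose M := \matrix_(i < d) poly_rV ((u * c i) %% g) : 'M[F]_(d, pdeg g).
  exists (index M e); first by rewrite -szE index_mem.
  rewrite (nth_map 0) ?index_mem // nth_index //; change (in_ideal g (y - rep M)).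
  have -> : y - rep M = emb (v * g) * y + \sum_i emb (g * ((u * c i) %/ g)) * x i.
    rewrite -[y in LHS]mul1r -(rmorph1 emb) -uv rmorphD mulrDl rmorphM -mulrA Dy.
    rewrite addrAC addrC; congr (_ + _); rewrite mulr_sumr -sumrB.
    apply: eq_bigr => i _; rewrite rowK poly_rV_K; last first.
      by rewrite -ltnS prednK ?size_poly_gt0 // ltn_modp.
    rewrite mulrA -rmorphM -mulrBl -rmorphB; congr (emb _ * _).
    by rewrite {1}(divp_eq (u * c i) g) addrK mulrC.
  apply: in_idealD; first by apply: in_ideal_emb => //; apply: dvdp_mull.
  by apply: in_ideal_sum => i _; apply: in_ideal_emb => //; apply: dvdp_mulr.
Qed.

(** Multiplying by a single [x i0], available since [d] is positive, turns the claim into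
    independence modulo [g]. *)
Lemma frame_in_ideal_emb (a : {poly F}) : (0 < d)%N -> in_ideal g (emb a) -> g %| a.
Proof.
move=> d_gt0 ga; have [p pr_p pcharFp] := finPcharP F.
pose i0 := Ordinal d_gt0; pose c i := if i == i0 then a else 0.
suff : in_ideal g (\sum_i emb (c i) * x i).
  by move=> /(frame_dvdp pcharFp ix discxD coDg)/(_ i0); rewrite /c eqxx.
rewrite (bigD1 i0) //= big1 => [|i /negPf ne]; last by rewrite /c ne rmorph0 mul0r.
by rewrite addr0 /c eqxx mulrC; apply: in_idealMl.
Qed.

(** A reducible [g] is [h * P] with both factors nonconstant; they are nonzero modulo [g] with
    product zero, so [P] cannot be inverted. *)
Lemma frame_not_field : (0 < d)%N -> reducible_poly g -> ~ quot_is_field (emb g).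
Proof.
move=> d_gt0 [g1 redg] [_ invg]; have [P irrP] := irreducible_factor g1.
case/dvdpP => h gE; have nzg : g != 0 by rewrite -size_poly_gt0 (ltn_trans _ g1).
have [nzh nzP] : h != 0 /\ P != 0.
  by move: nzg; rewrite gE mulf_eq0 negb_or => /andP.
have h1 : (1 < size h)%N.
  rewrite ltnNge; apply/negP => h1; apply: redg; have [k hk] : exists k, h = k%:P.
    by exists h`_0; apply: size1_polyC.
  have nzk : k != 0 by apply: contraNneq nzh => k0; rewrite hk k0.
  have gP : g %= P by rewrite gE hk mul_polyC eqp_scale.
  split=> // r r1 rg; apply: eqp_trans (irrP.2 r r1 _) _; last by rewrite eqp_sym.
  by rewrite -(eqp_dvdr _ gP).
have P1 : (1 < size P)%N := irrP.1.
have szg : size g = (size h + size P).-1 by rewrite gE size_mul.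
have nP : ~ in_ideal g (emb P).
  move=> /(frame_in_ideal_emb d_gt0)/(dvdp_leq nzP); rewrite szg leqNgt.
  by rewrite -(ltn_predK h1) addSn /= -{1}[size P]add0n ltn_add2r -ltnS (ltn_predK h1) h1.
have nh : ~ in_ideal g (emb h).
  move=> /(frame_in_ideal_emb d_gt0)/(dvdp_leq nzh); rewrite szg leqNgt.
  by rewrite -(ltn_predK P1) addnS /= -{1}[size h]addn0 ltn_add2l -ltnS (ltn_predK P1) P1.
have [||b ib Pb] := invg (emb P); first exact: integralK_emb.
  by rewrite /congrK subr0.
apply: nh; have -> : emb h = emb g * b - emb h * (emb P * b - 1).
  by rewrite mulrBr mulr1 mulrA -rmorphM -gE subKr.
apply: in_idealB; first by apply: in_ideal_emb.
by apply: in_idealMl; first exact: integralK_emb.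
Qed.

End Frame.

(** The hypothesis gives a separate family for each irreducible [P] dividing [g]. The Chinese
    remainder theorem glues them into one, and the discriminant modulo each [P] depends only on the
    family modulo [P]. *)
Lemma frame_exists (g : {poly F}) : squarefree_poly g -> disc_coprime K g ->
  exists x : 'I_(\dim {:K}) -> K, (forall i, integralK (x i)) /\
    exists2 D, discK x = D%:F & coprimep D g.
Proof.
have [p pr_p pcharFp] := finPcharP F.
move=> sqg discg.
pose good h := exists x : 'I_(\dim {:K}) -> K, (forall i, integralK (x i)) /\
  exists2 D, discK x = D%:F & coprimep D h.
apply: (squarefree_ind (T := good) sqg) => [u u1|P h irrP Pg coPh].
  (* Everything is coprime to a nonzero constant, so even the zero family qualifies. *)
  have i0 : forall i : 'I_(\dim {:K}), integralK (0 : K) by move=> _; exact: integralK0.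
  exists (fun=> 0); split=> //; have [D DE] := discK_integral pcharFp i0; exists D => //.
  by rewrite (eqp_coprimepr _ (_ : u %= 1)) ?coprimep1 // -size_poly_eq1 u1.
move=> [y [iy [E yE coEh]]].
have [w [iw nw]] : exists w : 'I_(\dim {:K}) -> K,
    (forall i, integralK (w i)) /\ ~ (exists h, discK w = (P * h)%:F).
  apply: NNPP => now; case: (discg P irrP Pg) => w iw; apply: NNPP => nw.
  by apply: now; exists w.
have [D' wD'] := discK_integral pcharFp iw.
have coD'P : coprimep D' P.
  rewrite coprimep_sym irreducible_poly_coprime //; apply/negP => /dvdpP[k D'E].
  by apply: nw; exists k; rewrite wD' D'E mulrC.
have [u [v uv]] := coprimep_bezout coPh.
pose z i := emb (u * P) * y i + emb (v * h) * w i.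
have iz i : integralK (z i).
  by apply: integralKD; apply: integralKM => //; apply: integralK_emb.
have zw i : in_ideal P (z i - w i).
  have -> : z i - w i = emb (u * P) * (y i - w i).
    rewrite /z -[in X in _ - X](mul1r (w i)) -(rmorph1 emb) -uv rmorphD mulrDl.
    by rewrite opprD addrACA subrr addr0 mulrBr.
  by apply: in_ideal_emb; [apply: integralKB | apply: dvdp_mull].
have zy i : in_ideal h (z i - y i).
  have -> : z i - y i = emb (v * h) * (w i - y i).
    rewrite /z -[in X in _ - X](mul1r (y i)) -(rmorph1 emb) -uv rmorphD mulrDl.
    by rewrite opprD addrACA subrr add0r mulrBr.
  by apply: in_ideal_emb; [apply: integralKB | apply: dvdp_mull].
exists z; split=> //; have [D zD] := discK_integral pcharFp iz; exists D => //.
rewrite coprimepMr (coprimep_congr (discK_in_ideal pcharFp iz iw zw zD wD') coD'P).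
exact: (coprimep_congr (discK_in_ideal pcharFp iz iy zy zD yE)).
Qed.

End Main.

Theorem theorem5p3 (F : finFieldType) (d : nat) (g : {poly F}) :
  (1 <= d)%N -> rigid_carmichael d g ->
  forall K : fieldExtType {fraction {poly F}},
    \dim {:K} = d -> separable 1%VS {:K} -> disc_coprime K g ->
    carmichael_in (embK K g).
Proof.
move=> d_gt0 [redg [sqg degg]] K dimK _ discg.
have [x [ix [D discxD coDg]]] := frame_exists sqg discg; rewrite dimK in x ix discxD.
have g1 := redg.1.
have nzD : D != 0.
  (* Zero is not coprime to the nonconstant [g]. *)
  by apply: contraTneq coDg => ->; rewrite coprime0p -size_poly_eq1 gtn_eqF.
split; first exact: integralK_emb.
exists (#|F| ^ (d * pdeg g))%N; split; [|split].
- exact: (frame_quot_card ix discxD dimK nzD coDg sqg.1).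
- exact: (frame_not_field ix discxD coDg).
move=> a ia; suff : in_ideal g (a ^+ (#|F| ^ (d * pdeg g)) - a) by [].
(* The exponent stays that of [g] while the modulus [h] grows factor by factor from a constant,
   which generates the unit ideal. *)
pose good h := in_ideal h (a ^+ (#|F| ^ (d * pdeg g)) - a).
apply: (squarefree_ind (T := good) sqg) => [u u1|P h irrP Pg coPh ha].
  rewrite /good -[_ - _]mul1r -(rmorph1 (embK K)); apply: in_ideal_emb.
    by apply: integralKB => //; apply: integralKX.
  by rewrite -(eqp_dvdl _ (_ : 1 %= u)) ?dvd1p // eqp_sym -size_poly_eq1 u1.
apply: in_ideal_coprime => //; apply: (expr_card_in_ideal ix discxD dimK nzD) => //.
  exact: coprimep_dvdl Pg coDg.
by move=> i; apply: degg.
Qed.
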